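(* Let $m,n\in\mathbb N$ be standard and $\mathcal A=(\alpha_{ij})_{m\times n}\in\mathcal M_{m,n}(\mathbb E)$ with $\operatorname{mr}(\mathcal A)=r$. Then there exists a linearly independent set of $r$ row vectors of $\mathcal A$. As a consequence, $r(\mathcal A)\ge\operatorname{mr}(\mathcal A)$.
   Context: We work in nonstandard analysis with external sets (the theory HST of Kanovei and Reeken, extending a bounded form of Nelson's IST), so $\mathbb R$ contains nonstandard numbers. A neutrix is a convex additive subgroup of $\mathbb R$ (possibly an external set). An external number is a set $\alpha=a+A=\{a+x: x\in A\}$ with $a\in\mathbb R$ and $A$ a neutrix; $\mathbb E$ is the class of external numbers. $\alpha$ is zeroless if $0\notin\alpha$; otherwise $\alpha$ is a neutrix. Operations are Minkowski operations: $(a+A)\pm(b+B)=(a\pm b)+(A+B)$, $(a+A)(b+B)=ab+aB+bA+AB$. $\mathcal M_{m,n}(\mathbb E)$ is the class of $m\times n$ matrices over $\mathbb E$. The determinant of a $k\times k$ matrix over $\mathbb E$ is $\sum_{\sigma\in S_k}\operatorname{sgn}(\sigma)\alpha_{1\sigma(1)}\cdots\alpha_{k\sigma(k)}$; a minor of order $k$ of $\mathcal A$ is the determinant of a $k\times k$ submatrix. A neutrix vector is a vector all of whose coordinates are neutrices. A set $\{\xi_1,\dots,\xi_p\}$ of vectors of $\mathbb E^n$ is linearly dependent if there exist real numbers $t_1,\dots,t_p$, not all zero, and a neutrix vector $A$ with $t_1\xi_1+\cdots+t_p\xi_p=A$; otherwise it is linearly independent. The row-rank $r(\mathcal A)$ is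 the maximal cardinality of a linearly independent subset of the set of row vectors of $\mathcal A$. The minor-rank $\operatorname{mr}(\mathcal A)$ is the largest natural number $k$ such that $\mathcal A$ has a zeroless minor of order $k$ ($0$ if there is none). *)

(* Defs.v *)
From HB Require Import structures.
From mathcomp Require Import all_boot all_order all_algebra perm.
From mathcomp Require Import boolp classical_sets functions cardinality.
From mathcomp Require Import set_interval reals.
From mathcomp Require Import ring lra.

Set Implicit Arguments.
Unset Strict Implicit.
Unset Printing Implicit Defensive.

Import Order.TTheory GRing.Theory Num.Theory.

Local Open Scope classical_set_scope.
Local Open Scope card_scope.
Local Open Scope ring_scope.

(* [nonstandard_extension std R] makes R a field of nonstandard reals over the
   complete ordered field std of standard reals. An n-ary relation A on std has
   an extension [star A] to R. Since [star] commutes with the Boolean operations,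
   with reindexing of variables, and with images under reindexing (existential
   quantification and, when f is not injective, equality), every first-order
   sentence over std, in the language of all standard relations, transfers to R.
   In HST, std is the set of reals of the well-founded universe (isomorphic to
   the standard universe) and R is the set of all internal reals. The naturals
   of std are [nat], so the standard naturals are the elements of [nat]. The
   external subsets of R are elements of [set R]. *)
Record nonstandard_extension (std : realType) (R : realFieldType) := {
  embed : {rmorphism std -> R};
  star : forall n : nat, set ('I_n -> std) -> set ('I_n -> R);
  star_embed : forall n (A : set ('I_n -> std)) x,
    star A (embed \o x) <-> A x;
  starI : forall n (A B : set ('I_n -> std)),
    star (A `&` B) = star A `&` star B;
  starC : forall n (A : set ('I_n -> std)), star (~` A) = ~` star A;
  star_preimage : forall n k (f : 'I_k -> 'I_n) (A : set ('I_k -> std)),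
    star [set x : 'I_n -> std | A (x \o f)] =
      [set x : 'I_n -> R | star A (x \o f)];
  star_image : forall n k (f : 'I_k -> 'I_n) (A : set ('I_n -> std)),
    star [set (x : 'I_n -> std) \o f | x in A] =
      [set (x : 'I_n -> R) \o f | x in star A];
  star_add : star [set x : 'I_3 -> std | x 0 + x 1 = x 2] =
    [set x : 'I_3 -> R | x 0 + x 1 = x 2];
  star_mul : star [set x : 'I_3 -> std | x 0 * x 1 = x 2] =
    [set x : 'I_3 -> R | x 0 * x 1 = x 2];
  star_le : star [set x : 'I_2 -> std | x 0 <= x 1] =
    [set x : 'I_2 -> R | x 0 <= x 1];
  has_infinite : exists w : R, forall x : std, embed x < w
}.

Section Neutrices.
Context {R : realFieldType}.
Implicit Types A B N : set R.

Definition convex A := forall x y, A x -> A y ->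
  forall z, x <= z <= y -> A z.

Definition neutrix A := zmod_closed (mem A) /\ convex A.

Definition set_add A B := [set x + y | x in A & y in B].
Definition set_mul A B := [set x * y | x in A & y in B].

Lemma neutrixP A : neutrix A <->
  [/\ A 0, forall x y, A x -> A y -> A (x - y)
    & forall x z, A x -> `|z| <= `|x| -> A z].
Proof.
split=> [[[A0 AB] Ai]|[A0 AB As]].
  have {}A0 : A 0 by move: A0; rewrite inE.
  have {}AB x y : A x -> A y -> A (x - y).
    by move=> Ax Ay; have := AB x y; rewrite !inE; apply.
  have AN x : A x -> A (- x) by move=> Ax; rewrite -sub0r; apply: AB.
  split=> // x z Ax; rewrite ler_norml => zx.
  have Anx : A `|x| by case: (ger0P x) => _ //; apply: AN.
  exact: (Ai _ _ (AN _ Anx) Anx).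
have AD x y : A x -> A y -> A (x + y).
  by move=> Ax Ay; rewrite -[y]opprK -[- y]sub0r; apply/AB/AB.
split; first by split=> [|x y]; rewrite !inE //; apply: AB.
move=> x y Ax Ay z /andP[xz zy].
have h : A (`|x| + `|y|) by apply: AD; [apply: (As x)|apply: (As y)];
  rewrite // normr_id.
apply: As h _; rewrite [leRHS]ger0_norm ?addr_ge0// ler_norml.
have := ler_norm y; have := lerNnormlW (lexx `|x|).
have := normr_ge0 x; have := normr_ge0 y; lra.
Qed.

Lemma neutrixD A x y : neutrix A -> A x -> A y -> A (x + y).
Proof.
move=> /neutrixP[A0 AB _] Ax Ay.
by rewrite -[y]opprK -[- y]sub0r; apply/AB/AB.
Qed.

Lemma neutrix_ler A x z k : neutrix A -> A x -> `|z| <= `|x| *+ k -> A z.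
Proof.
move=> nA Ax; have [A0 _ As] := (neutrixP A).1 nA.
rewrite -normrMn; apply: As.
by elim: k => [|k IH]; rewrite ?mulr0n// mulrS; apply: neutrixD.
Qed.

Lemma neutrix0 : neutrix [set 0].
Proof.
apply/neutrixP; split=> //= [x y -> ->|x z ->]; first by rewrite subr0.
by rewrite normr0 normr_le0 => /eqP.
Qed.

Lemma neutrix_add A B : neutrix A -> neutrix B -> neutrix (set_add A B).
Proof.
move=> nA nB; have [A0 AB As] := (neutrixP A).1 nA.
have [B0 BB Bs] := (neutrixP B).1 nB.
apply/neutrixP; split; first by exists 0 => //; exists 0; rewrite ?addr0.
  move=> _ _ [x Ax [y By <-]] [x' Ax' [y' By' <-]].
  exists (x - x'); first exact: AB.
  by exists (y - y'); [apply: BB|ring].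
move=> _ z [x Ax [y By <-]] zxy.
have := le_trans zxy (ler_normD x y).
have [xy|/ltW xy] := leP `|y| `|x| => h.
  exists z; last by exists 0; rewrite ?addr0.
  by apply: (@neutrix_ler A x _ 2) => //; rewrite mulr2n; lra.
exists 0 => //; exists z; last by rewrite add0r.
by apply: (@neutrix_ler B y _ 2) => //; rewrite mulr2n; lra.
Qed.

Lemma neutrix_mul A B : neutrix A -> neutrix B -> neutrix (set_mul A B).
Proof.
move=> nA nB; have [A0 AB As] := (neutrixP A).1 nA.
have [B0 BB Bs] := (neutrixP B).1 nB.
have S w z : set_mul A B w -> `|z| <= `|w| -> set_mul A B z.
  move=> [x Ax [y By <-]].
  have [->|y0] := eqVneq y 0.
    rewrite mulr0 normr0 normr_le0 => /eqP ->.
    by exists 0 => //; exists 0; rewrite ?mulr0.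
  rewrite normrM -ler_pdivrMr ?normr_gt0// -normf_div => h.
  by exists (z / y); [apply: As h|exists y; rewrite // divfK].
apply/neutrixP; split=> //; first by exists 0 => //; exists 0; rewrite ?mulr0.
move=> _ _ [x Ax [y By <-]] [x' Ax' [y' By' <-]].
have An u : A u -> A `|u| by move=> /As; apply; rewrite normr_id.
have Bn u : B u -> B `|u| by move=> /Bs; apply; rewrite normr_id.
apply: (S ((Num.max `|x| `|x'| *+ 2) * Num.max `|y| `|y'|)).
  exists (Num.max `|x| `|x'| *+ 2).
    by rewrite mulr2n; apply: neutrixD => //; case: leP => _; apply: An.
  by exists (Num.max `|y| `|y'|) => //; case: (leP `|y|) => _; apply: Bn.
rewrite [leRHS]ger0_norm; last first.
  by rewrite mulr_ge0 ?mulrn_wge0// le_max normr_ge0.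
apply: (le_trans (ler_normB _ _)); rewrite mulrnAl mulr2n !normrM.
by apply: lerD; apply: ler_pM; rewrite // le_max lexx ?orbT.
Qed.

Lemma neutrix_scale a B : neutrix B -> neutrix (set_mul [set a] B).
Proof.
move=> nB; have [B0 BB Bs] := (neutrixP B).1 nB.
apply/neutrixP; split.
- by exists a => //; exists 0; rewrite ?mulr0.
- move=> _ _ [_ -> [y By <-]] [_ -> [y' By' <-]].
  by exists a => //; exists (y - y'); [apply: BB|ring].
- move=> _ z [_ -> [y By <-]] h; exists a => //.
  have [a0|a0] := eqVneq a 0.
    exists 0 => //; move: h; rewrite a0 mul0r normr0 normr_le0 => /eqP ->.
    by rewrite mul0r.
  exists (z / a); last by rewrite mulrC divfK.
  apply: Bs By _.
  by rewrite normf_div ler_pdivrMr ?normr_gt0// mulrC -normrM.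
Qed.

Definition is_external A :=
  exists a N, neutrix N /\ A = set_add [set a] N.

Lemma set_add1P a N z : set_add [set a] N z <-> N (z - a).
Proof.
split=> [[_ -> [y Ny <-]]|Nz]; first by rewrite addrC addKr.
by exists a => //; exists (z - a); rewrite // addrC subrK.
Qed.

Lemma set_addE a b A B :
  set_add (set_add [set a] A) (set_add [set b] B) =
  set_add [set a + b] (set_add A B).
Proof.
apply/seteqP; split=> z.
  move=> [_ [_ -> [x Ax <-]] [_ [_ -> [y By <-]] <-]].
  exists (a + b) => //; exists (x + y); last by ring.
  by exists x => //; exists y.
move=> [_ -> [_ [x Ax [y By <-]] <-]].
exists (a + x); first by exists a => //; exists x.
by exists (b + y); [exists b => //; exists y|ring].
Qed.

(* (a + A)(b + B) = ab + (aB + bA + AB). *)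
Lemma set_mulE a b A B : neutrix A -> neutrix B ->
  set_mul (set_add [set a] A) (set_add [set b] B) =
  set_add [set a * b]
    (set_add (set_add (set_mul [set a] B) (set_mul [set b] A)) (set_mul A B)).
Proof.
move=> nA nB; have [A0 AB As] := (neutrixP A).1 nA.
have [B0 BB Bs] := (neutrixP B).1 nB.
apply/seteqP; split=> z.
  move=> [_ [_ -> [x Ax <-]] [_ [_ -> [y By <-]] <-]].
  exists (a * b) => //; exists (a * y + b * x + x * y); last by ring.
  exists (a * y + b * x); last by exists (x * y) => //; exists x => //; exists y.
  exists (a * y); first by exists a => //; exists y.
  by exists (b * x) => //; exists b => //; exists x.
move=> /set_add1P[_ [_ [_ -> [y By <-]] [_ [_ -> [x Ax <-]] <-]]].
move=> [_ [x' Ax' [y' By' <-]] zE].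
pose X := Num.max `|x| `|x'|; pose Y := Num.max `|y| `|y'|.
have AX : A X by rewrite /X; case: leP => _; [apply: As Ax' _|apply: As Ax _];
  rewrite normr_id.
have BY : B Y by rewrite /Y; case: leP => _; [apply: Bs By' _|apply: Bs By _];
  rewrite normr_id.
have X0 : 0 <= X by rewrite le_max normr_ge0.
have Y0 : 0 <= Y by rewrite le_max normr_ge0.
have zB : `|z - a * b| <= `|a| * Y + `|b| * X + X * Y.
  rewrite -zE; apply: (le_trans (ler_normD _ _)); rewrite normrM.
  apply: lerD; last by apply: ler_pM; rewrite // le_max lexx ?orbT.
  apply: (le_trans (ler_normD _ _)); rewrite !normrM.
  by apply: lerD; apply: ler_wpM2l; rewrite // le_max lexx.
have R0 u v : u = a * b -> v = u ->
    set_mul (set_add [set a] A) (set_add [set b] B) v.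
  move=> -> ->; exists a; first by apply/set_add1P; rewrite subrr.
  by exists b; first by apply/set_add1P; rewrite subrr.
have [a0Y|] := boolP [&& a != 0, `|b| * X <= `|a| * Y & X * Y <= `|a| * Y].
  have /and3P[a0 h1 h2] := a0Y.
  exists a; first by apply/set_add1P; rewrite subrr.
  exists (z / a); last by rewrite mulrC divfK.
  apply/set_add1P.
  have -> : z / a - b = (z - a * b) / a by field.
  apply: (@neutrix_ler B Y _ 3) => //.
  rewrite normf_div ler_pdivrMr ?normr_gt0// (ger0_norm Y0) mulrnAl.
  by rewrite mulrSr mulr2n; lra.
move=> na.
have [b0X|] := boolP [&& b != 0, `|a| * Y <= `|b| * X & X * Y <= `|b| * X].
  have /and3P[b0 h1 h2] := b0X.
  exists (z / b); last first.
    by exists b; [apply/set_add1P; rewrite subrr|rewrite divfK].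
  apply/set_add1P.
  have -> : z / b - a = (z - a * b) / b by field.
  apply: (@neutrix_ler A X _ 3) => //.
  rewrite normf_div ler_pdivrMr ?normr_gt0// (ger0_norm X0) mulrnAl.
  by rewrite mulrSr mulr2n; lra.
move=> nb.
have [XY0|XY0] := eqVneq (X * Y) 0.
  have [a0|a0] := eqVneq a 0; have [b0|b0] := eqVneq b 0.
  - apply: (R0 (a * b)) => //; apply/eqP; rewrite -subr_eq0 -normr_le0.
    by move: zB; rewrite a0 b0 XY0 normr0; lra.
  - by move: nb; rewrite b0 XY0 a0 normr0 mul0r mulr_ge0.
  - by move: na; rewrite a0 XY0 b0 normr0 mul0r mulr_ge0.
  - move: na nb; rewrite a0 b0 XY0 !mulr_ge0// !andbT/=.
    by case: leP => //= /ltW ->.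
move: XY0; rewrite mulf_eq0 negb_or => /andP[X1 Y1].
have {}X1 : 0 < X by rewrite lt0r X1.
have {}Y1 : 0 < Y by rewrite lt0r Y1.
have XY1 : 0 < X * Y by rewrite mulr_gt0.
have [h1 h2] : `|a| * Y <= X * Y /\ `|b| * X <= X * Y.
  have [a0|a0] := eqVneq a 0; have [b0|b0] := eqVneq b 0;
    move: na nb; rewrite ?a0 ?b0 /= ?normr0 ?mul0r;
    have ap := mulr_ge0 (normr_ge0 a) Y0; have bp := mulr_ge0 (normr_ge0 b) X0;
    rewrite ?ap ?bp ?(ltW XY1) /=.
  - by split.
  - by rewrite -ltNge => _ /ltW ->.
  - by rewrite -ltNge => /ltW ->.
  - by case: (leP (`|b| * X)) => h /=; [|rewrite (ltW h) /=];
      rewrite -?ltNge => h1 h2; split; lra.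
have Aa : A a by apply: As AX _; rewrite (ger0_norm X0) -(ler_pM2r Y1).
have Bb : B b.
  by apply: Bs BY _; rewrite (ger0_norm Y0) -(ler_pM2r X1) [leRHS]mulrC.
exists (z / Y); last first.
  exists Y; first by apply/set_add1P; apply: BB.
  by rewrite divfK // gt_eqF.
apply/set_add1P; apply: AB => //; apply: (@neutrix_ler A X _ 4) => //.
rewrite normf_div (ger0_norm X0) (ger0_norm Y0) ler_pdivrMr// mulrnAl.
have : `|a * b| <= X * Y.
  rewrite normrM; apply: ler_pM => //.
    by rewrite -(ler_pM2r Y1).
  by rewrite -(ler_pM2r X1) [leRHS]mulrC.
have := ler_normD (z - a * b) (a * b); rewrite subrK.
by rewrite 2!mulrSr mulr2n; lra.
Qed.

Lemma is_external1 a : is_external [set a].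
Proof.
exists a, [set 0]; split; first exact: neutrix0.
apply/seteqP; split=> z; rewrite set_add1P/=; first by move->; rewrite subrr.
by move/eqP; rewrite subr_eq0 => /eqP.
Qed.

Lemma is_externalD A B :
  is_external A -> is_external B -> is_external (set_add A B).
Proof.
move=> [a [M [nM ->]]] [b [N [nN ->]]].
exists (a + b), (set_add M N); split; first exact: neutrix_add.
exact: set_addE.
Qed.

Lemma is_externalM A B :
  is_external A -> is_external B -> is_external (set_mul A B).
Proof.
move=> [a [M [nM ->]]] [b [N [nN ->]]]; eexists; eexists.
split; last exact: set_mulE.
by apply: neutrix_add; [apply: neutrix_add; apply: neutrix_scale
                       |apply: neutrix_mul].
Qed.

End Neutrices.

Record external (R : realFieldType) := External {
  eset :> set R;
  esetP : is_external eset
}.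

HB.instance Definition _ (R : realFieldType) := gen_eqMixin (external R).
HB.instance Definition _ (R : realFieldType) := gen_choiceMixin (external R).

Section External.
Context {R : realFieldType}.
Implicit Types a b c : external R.

Lemma external_inj a b : eset a = eset b -> a = b.
Proof.
by case: a b => [A hA] [B hB] /= AB; case: _ / AB hB => hB; congr External.
Qed.

Definition ext_real (x : R) : external R := External (is_external1 x).
Definition ext_add a b : external R :=
  External (is_externalD (esetP a) (esetP b)).
Definition ext_mul a b : external R :=
  External (is_externalM (esetP a) (esetP b)).

Lemma ext_addA : associative ext_add.
Proof.
move=> a b c; apply: external_inj; apply/seteqP; split=> z /=.
  move=> [x ax [_ [y hy [w hw <-]] <-]]; exists (x + y); last first.
    by exists w; rewrite // addrA.
  by exists x => //; exists y.
move=> [_ [x ax [y hy <-]] [w hw <-]]; exists x => //.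
by exists (y + w); rewrite ?addrA//; exists y => //; exists w.
Qed.

Lemma ext_addC : commutative ext_add.
Proof.
move=> a b; apply: external_inj; apply/seteqP; split=> _ /= [x ? [y ? <-]];
by exists y => //; exists x; rewrite // addrC.
Qed.

Lemma ext_add0 : left_id (ext_real 0) ext_add.
Proof.
move=> a; apply: external_inj; apply/seteqP; split=> z /=.
  by move=> [_ -> [y ay <-]]; rewrite add0r.
by move=> az; exists 0 => //; exists z; rewrite // add0r.
Qed.

Lemma ext_mulA : associative ext_mul.
Proof.
move=> a b c; apply: external_inj; apply/seteqP; split=> z /=.
  move=> [x ax [_ [y hy [w hw <-]] <-]]; exists (x * y); last first.
    by exists w; rewrite // mulrA.
  by exists x => //; exists y.
move=> [_ [x ax [y hy <-]] [w hw <-]]; exists x => //.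
by exists (y * w); rewrite ?mulrA//; exists y => //; exists w.
Qed.

Lemma ext_mulC : commutative ext_mul.
Proof.
move=> a b; apply: external_inj; apply/seteqP; split=> _ /= [x ? [y ? <-]];
by exists y => //; exists x; rewrite // mulrC.
Qed.

Lemma ext_mul1 : left_id (ext_real 1) ext_mul.
Proof.
move=> a; apply: external_inj; apply/seteqP; split=> z /=.
  by move=> [_ -> [y ay <-]]; rewrite mul1r.
by move=> az; exists 1 => //; exists z; rewrite // mul1r.
Qed.

End External.

(* Multiplication is not distributive over addition and a - a need not be 0, so
   [external R] is only an additive and a multiplicative commutative monoid. *)
HB.instance Definition _ (R : realFieldType) :=
  GRing.isNmodule.Build (external R) ext_addA ext_addC ext_add0.
HB.instance Definition _ (R : realFieldType) :=
  Monoid.isComLaw.Build (external R) (ext_real 1) ext_mul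
    ext_mulA ext_mulC ext_mul1.

Section Matrices.
Context {R : realFieldType}.

Definition zeroless (a : external R) := ~ eset a 0.

Definition ext_det k (A : 'M[external R]_k) : external R :=
  \sum_(s : 'S_k) ext_mul (ext_real ((-1) ^+ s))
    (\big[ext_mul/ext_real 1]_(i < k) A i (s i)).

Definition has_zeroless_minor m n (A : 'M[external R]_(m, n)) (k : nat) :=
  exists (f : 'I_k -> 'I_m) (g : 'I_k -> 'I_n),
    [/\ {homo f : i j / (i < j)%N}, {homo g : i j / (i < j)%N}
      & zeroless (ext_det (mxsub f g A))].

Definition minor_rank m n (A : 'M[external R]_(m, n)) : nat :=
  \max_(k < (minn m n).+1 | `[< has_zeroless_minor A k >]) k.

Definition neutrix_vector n (v : 'rV[external R]_n) :=
  forall j, neutrix (eset (v ord0 j)).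

Definition ext_scale n (t : R) (v : 'rV[external R]_n) : 'rV[external R]_n :=
  map_mx (ext_mul (ext_real t)) v.

(* Only meaningful for finite X; the enumeration xi lists every element of X
   exactly once. *)
Definition lin_dependent n (X : set 'rV[external R]_n) :=
  exists (p : nat) (xi : 'I_p -> 'rV[external R]_n) (t : 'I_p -> R)
      (N : 'rV[external R]_n),
    [/\ set_bij [set: 'I_p] X xi, exists i, t i != 0, neutrix_vector N
      & \sum_i ext_scale (t i) (xi i) = N].

Definition lin_independent n (X : set 'rV[external R]_n) := ~ lin_dependent X.

Definition row_vectors m n (A : 'M[external R]_(m, n)) :
    set 'rV[external R]_n :=
  range (fun i => row i A).

Definition has_independent_rows m n (A : 'M[external R]_(m, n)) (p : nat) :=
  exists X : set 'rV[external R]_n,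
    [/\ X `<=` row_vectors A, X #= `I_p & lin_independent X].

Definition row_rank m n (A : 'M[external R]_(m, n)) : nat :=
  \max_(p < m.+1 | `[< has_independent_rows A p >]) p.

End Matrices.

(* Main.v *)
Require Import Defs.
From mathcomp Require Import all_boot all_order all_algebra perm.
From mathcomp Require Import boolp classical_sets functions cardinality reals.

(** The determinant of a matrix over the external numbers is built from Minkowski
    sums and products, so it contains the determinant of every real matrix that
    represents it, that is, whose entries are chosen in the corresponding external
    entries ([ext_det_mem]). A zeroless determinant therefore forces all the
    representatives to be nonsingular.

    Take a zeroless minor of order [k]. Its rows come from [k] distinct rows of
    [A]: two equal rows could be represented by equal real rows, which would
    give a singular representative ([zeroless_det_rows_inj]). If these rows of
    [A] were linearly dependent, with real coefficients [t], each column of the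
    combination would be a neutrix, hence contain 0. Membership of 0 in a
    Minkowski sum means that representatives of the entries of that column can
    be chosen with combination exactly 0 ([ext_sum_memP]). Doing this in each of
    the [k] columns of the minor gives a representative killed by the nonzero
    row vector [t], hence singular: a contradiction
    ([zeroless_det_independent]). So a zeroless minor of order [k] yields [k]
    independent rows ([zeroless_minor_independent_rows]). *)

Import GRing.Theory.

Local Open Scope classical_set_scope.
Local Open Scope card_scope.
Local Open Scope ring_scope.

Section ExternalRepresentatives.
Context {R : realFieldType}.

Lemma external_nonempty (a : external R) : exists x, eset a x.
Proof.
have [c [N [nN aE]]] := esetP a; exists c; rewrite aE.
by apply/set_add1P; rewrite subrr; have [] := (neutrixP N).1 nN.
Qed.

Lemma ext_sum_mem {I : finType} {F : I -> external R} {x : I -> R} :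
  (forall i, eset (F i) (x i)) -> eset (\sum_i F i) (\sum_i x i).
Proof.
move=> Fx; apply: (big_ind2 (fun (a : external R) y => eset a y)) => //.
by move=> a y b z ay bz; exists y => //; exists z.
Qed.

Lemma ext_prod_mem {I : finType} {F : I -> external R} {x : I -> R} :
  (forall i, eset (F i) (x i)) ->
  eset (\big[ext_mul/ext_real 1]_i F i) (\prod_i x i).
Proof.
move=> Fx; apply: (big_ind2 (fun (a : external R) y => eset a y)) => //.
by move=> a y b z ay bz; exists y => //; exists z.
Qed.

(** Every element of a Minkowski sum is an exact sum of representatives. This is
    what turns a membership of 0 into a genuine real linear relation. *)
Lemma ext_sum_memP {I : finType} {F : I -> external R} {z : R} :
  eset (\sum_i F i) z ->
  exists2 x : I -> R, (forall i, eset (F i) (x i)) & \sum_i x i = z.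
Proof.
have := index_enum_uniq I; elim: (index_enum I) z => [|i s IHs] z /=.
  move=> _; rewrite big_nil => ->.
  have [x Fx] := boolp.choice (fun i => external_nonempty (F i)).
  by exists x => //; rewrite big_nil.
move=> /andP[i_s /IHs{}IHs]; rewrite big_cons => -[y Fy [w /IHs[x Fx <-] <-]].
(* Redefining [x] at [i] leaves the tail sum unchanged, as [i] occurs only once. *)
exists (fun j => if j == i then y else x j) => [j|].
  by case: eqP => [->|_].
rewrite big_cons eqxx; congr (_ + _); apply: eq_big_seq => j js.
by case: eqP => // ji; rewrite -ji js in i_s.
Qed.

(** Only this inclusion holds in general: the Minkowski expansion chooses a
    representative of an entry anew in each of the products in which it occurs. *)
Lemma ext_det_mem {k} {A : 'M[external R]_k} {a : 'M[R]_k} :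
  (forall i j, eset (A i j) (a i j)) -> eset (ext_det A) (\det a).
Proof.
move=> Aa; apply: ext_sum_mem => s; exists ((-1) ^+ s) => //.
by exists (\prod_i a i (s i)) => //; apply: ext_prod_mem.
Qed.

(** Linear dependence is defined for sets of rows, so a repeated row would lower
    the cardinality; a zeroless determinant excludes this. *)
Lemma zeroless_det_rows_inj {k} {A : 'M[external R]_k} :
  zeroless (ext_det A) -> injective (fun i => row i A).
Proof.
move=> A0 i i' /= /rowP Aii'; apply: contrapT => /eqP ii'; apply: A0.
(* The representative of an entry depends only on the value of that entry, so
   equal external rows get equal real rows. *)
have [rep repP] := boolp.choice external_nonempty.
have := ext_det_mem (A := A) (a := map_mx rep A).
rewrite (determinant_alternate ii') => [|j].
  by apply=> p q; rewrite mxE.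
by have := Aii' j; rewrite !mxE => ->.
Qed.

(** The coefficients [t i] are precise real numbers common to all columns, so the
    representatives may be chosen column by column and still assemble into one
    real matrix with [t] in its left kernel. *)
Lemma zeroless_det_independent {k} {A : 'M[external R]_k} {t : 'I_k -> R} :
  zeroless (ext_det A) ->
  (forall j, eset (\sum_i ext_mul (ext_real (t i)) (A i j)) 0) ->
  forall i, t i = 0.
Proof.
move=> A0 At0 i.
have /boolp.choice[a aP] j : exists x : 'I_k -> R,
    (forall i, eset (A i j) (x i)) /\ \sum_i t i * x i = 0.
  have [y Ay y0] := ext_sum_memP (At0 j).
  have /boolp.choice[x Ax] i' : exists w, eset (A i' j) w /\ t i' * w = y i'.
    by have [_ -> [w Aw <-]] := Ay i'; exists w.
  exists x; split=> [i'|]; first by have [] := Ax i'.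
  by rewrite -[RHS]y0; apply: eq_bigr => i' _; have [] := Ax i'.
pose M := \matrix_(i', j) a j i'; pose T := \row_i' t i'.
have TM : T *m M = 0.
  apply/rowP=> j; rewrite !mxE -[RHS](aP j).2.
  by apply: eq_bigr => i' _; rewrite !mxE.
apply: contrapT => /eqP ti0; apply: A0.
have /eqP <- : \det M == 0.
  apply/det0P; exists T => //; apply: contra_neq ti0 => /rowP/(_ i).
  by rewrite !mxE.
by apply: ext_det_mem => i' j; rewrite mxE; apply: (aP j).1.
Qed.

Lemma independent_rows0 m n (A : 'M[external R]_(m, n)) :
  has_independent_rows A 0.
Proof.
exists set0; split; [exact: sub0set | by rewrite II0 |].
by move=> [p [xi [t [N [[xi0 _ _] [i _] _ _]]]]]; exact: (xi0 i).
Qed.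

(** A dependence among the full rows restricts to the columns of the minor, where
    the neutrix coordinates contain 0. *)
Lemma zeroless_minor_independent_rows m n (A : 'M[external R]_(m, n)) k :
  has_zeroless_minor A k -> has_independent_rows A k.
Proof.
move=> [f [g [_ _ A0]]].
pose rw (i : 'I_k) := row (f i) A.
have rw_inj : injective rw.
  move=> i i' /rowP fii'; apply: (zeroless_det_rows_inj A0).
  by apply/rowP=> j; have := fii' (g j); rewrite !mxE.
exists (range rw); split.
- by move=> _ [i _ <-]; exists (f i).
- apply: card_eq_trans (inj_card_eq _) _ => [i i' _ _|]; first exact: rw_inj.
  by rewrite card_eq_sym; exact: card_II.
move=> [p [xi [t [N [[xiX xi_inj xi_surj] [q tq0] nN xiN]]]]].
(* A dependence comes with its own enumeration [xi] of the rows; [h] matches it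
   with the indexing by rows of the minor. *)
have /boolp.choice[h hP] (i : 'I_k) : exists q', xi q' = rw i.
  by have [|q' _ <-] := xi_surj (rw i); [exists i | exists q'].
have h_inj : injective h.
  by move=> i i' hii'; apply: rw_inj; rewrite -!hP hii'.
have /boolp.choice[h' h'P] q' : exists i, h i = q'.
  have [|i _ rwi] := xiX q'; first by [].
  by exists i; apply: xi_inj; rewrite ?in_setE // hP.
have h_bij : bijective h by exists h' => // i; apply: h_inj; rewrite h'P.
suff th0 i : t (h i) = 0 by rewrite -(h'P q) th0 eqxx in tq0.
apply: (zeroless_det_independent (t := t \o h) A0) => {i} j.
have := nN (g j); rewrite -xiN summxE => /neutrixP[+ _ _].
rewrite (reindex h) /=; last exact: onW_bij.
congr (eset _ 0); apply: eq_bigr => i _.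
by rewrite !mxE hP !mxE.
Qed.

End ExternalRepresentatives.

Theorem theorem7p9 (std : realType) (R : realFieldType)
    (HR : nonstandard_extension std R) (m n : nat)
    (A : 'M[external R]_(m, n)) (r : nat) (hr : minor_rank A = r) :
  (exists X : set 'rV[external R]_n,
     [/\ X `<=` row_vectors A, X #= `I_r & lin_independent X]) /\
  (minor_rank A <= row_rank A)%N.
Proof.
split.
  rewrite -/(has_independent_rows A r) -hr /minor_rank.
  (* Induction on the maximum also covers order 0, the value of an empty maximum. *)
  apply: big_ind => [|x y Ax Ay|k /asboolP]; first exact: independent_rows0.
    by rewrite /maxn; case: ifP.
  exact: zeroless_minor_independent_rows.
apply/bigmax_leqP => k /asboolP/zeroless_minor_independent_rows Ak.
have km : (k < m.+1)%N by apply: leq_trans (ltn_ord k) _; rewrite ltnS geq_minl.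
by apply: (leq_bigmax_cond (Ordinal km)); apply/asboolP.
Qed.
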